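(* Let $\mathcal{H}$ be a separable Hilbert space and, for each $i\in I$, let $T_i=P_i$ be the metric projector onto a nonempty, closed and convex set $C_i\subset\mathcal{H}$. Assume $C\neq\emptyset$ and that there exists $\kappa>0$ such that $\operatorname{dist}^2(x,C)\le\kappa R(x)$ for all $x\in\mathcal{H}$. Then the probability of any point being feasible is uniformly bounded away from $1$ off $C$: there is $r<1$ such that $$\mathbb{P}(x\in C_\xi)\le r<1\qquad\forall x\in\mathcal{H}\setminus C.$$
   Context: Setting: $\mathcal{H}$ is a Hilbert space with norm $\|\cdot\|$ and Borel $\sigma$-algebra $\mathcal{B}(\mathcal{H})$; $(I,\mathcal{I})$ is a measurable space; $(T_i)_{i\in I}$ is a family of continuous maps $T_i:\mathcal{H}\to\mathcal{H}$ such that $\Phi:\mathcal{H}\times I\to\mathcal{H}$, $\Phi(x,i)=T_ix$, is measurable. $(\Omega,\mathcal{F},\mathbb{P})$ is a probability space and $\xi:\Omega\to I$ is measurable. $\operatorname{Fix}T_i=\{x: T_ix=x\}$ (so $\operatorname{Fix}P_i=C_i$) and $C:=\{x\in\mathcal{H}:\mathbb{P}(x\in\operatorname{Fix}T_\xi)=1\}=\{x:\mathbb{P}(x\in C_\xi)=1\}$; the standing assumption is $C\ne\emptyset$. $R(x):=\mathbb{E}[\|x-T_\xi x\|^2]$ and $\operatorname{dist}(x,C)=\inf_{c\in C}\|x-c\|$. *)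

(* Defs.v *)
From HB Require Import structures.
From mathcomp Require Import all_boot all_order all_algebra.
From mathcomp Require Import all_classical all_reals all_analysis.
Import Order.TTheory GRing.Theory Num.Theory.
Import numFieldNormedType.Exports.

Set Implicit Arguments.
Unset Strict Implicit.
Unset Printing Implicit Defensive.

Local Open Scope classical_set_scope.
Local Open Scope ring_scope.

Notation borel H := (g_sigma_algebraType (@open H)).

Definition separable (T : topologicalType) : Prop :=
  exists2 D : set T, countable D & dense D.

(* With [H] complete, this makes [H] a real Hilbert space with inner product
   [ip]; a [{dot H for idfun}] is a symmetric, positive definite bilinear
   form. *)
Definition norm_induced_by (R : realType) (H : normedModType R)
    (ip : {dot H for idfun}) : Prop :=
  forall x : H, `|x| ^+ 2 = ip x x.

(* The infimum is taken in [R], so this is meaningful only for nonempty [A]. *)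
Definition dist (R : realType) (H : normedModType R) (x : H) (A : set H) : R :=
  inf [set `|x - a| | a in A].

Definition argmin (T : Type) (R : realType) (A : set T) (f : T -> R) : set T :=
  [set y | A y /\ forall a, A a -> f y <= f a].

(* For closed convex nonempty [A] in a Hilbert space the nearest point is
   unique, hence [p] is determined by [A]. *)
Definition metric_projector (R : realType) (H : normedModType R) (A : set H)
    (p : H -> H) : Prop :=
  forall x, argmin A (fun a => `|x - a|) (p x).

Definition Fix (T : Type) (f : T -> T) : set T := [set x | f x = x].

Section stochastic_feasibility.
Context (R : realType) (H : normedModType R) (I : Type).
Context (d : measure_display) (Omega : measurableType d).
Context (P : probability Omega R) (T : I -> H -> H) (xi : Omega -> I).

Definition feasible : set H :=
  [set x | P [set w | Fix (T (xi w)) x] = 1%E].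

Definition residual (x : H) : \bar R :=
  ('E_P[fun w => (`|x - T (xi w) x| ^+ 2)%R])%E.

End stochastic_feasibility.

(* Main.v *)
(* Almost surely every c in C lies in C_xi, hence |x - P_xi x| <= |x - c|, while
   |x - P_xi x| = 0 when x is in C_xi.  Thus
   R(x) <= dist(x, C)^2 * P(x notin C_xi), and the regularity bound gives
   dist(x, C)^2 <= kappa * dist(x, C)^2 * P(x notin C_xi).  Off C the distance is
   positive, for otherwise R(x) = 0, i.e. x = P_xi x almost surely; so
   P(x in C_xi) <= 1 - 1/kappa. *)
Require Import Defs.
From mathcomp Require Import all_boot all_order all_algebra.
From mathcomp Require Import all_classical all_reals all_analysis.
From mathcomp Require Import measurable_realfun.
Import Order.TTheory GRing.Theory Num.Theory.
Import numFieldNormedType.Exports.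

Set Implicit Arguments.
Unset Strict Implicit.

Local Open Scope classical_set_scope.
Local Open Scope ring_scope.

(** A point of [A] is at distance 0 from itself, so its nearest point in [A] is at distance 0 too.
    This translates between [feasible], phrased with fixed points, and the events on [Cs]. *)
Lemma Fix_metric_projector (R : realType) (H : normedModType R) (A : set H)
    (p : H -> H) :
  metric_projector A p -> Fix p = A.
Proof.
move=> pA; apply/seteqP; split=> [x <-|x Ax]; first by case: (pA x).
case: (pA x) => _ /(_ x Ax); rewrite subrr normr0 normr_le0 subr_eq0.
by move/eqP.
Qed.

(** For [q > 0] the number [Num.sqrt (s / q)] is a lower bound of the distances [|x - a|], hence of
    their infimum. Applied to already integrated bounds, it avoids uniting the exceptional null sets
    of all [c] in [A]. *)
Lemma le_mul_sqr_dist (R : realType) (H : normedModType R) (x : H) (A : set H)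
    (q s : R) :
  A !=set0 -> 0 <= q -> 0 <= s ->
  (forall a, A a -> s <= q * `|x - a| ^+ 2) -> s <= q * dist x A ^+ 2.
Proof.
(* Division by [q] needs [q] nonzero; for [q = 0] a single point of [A] already gives [s <= 0]. *)
move=> [a0 Aa0]; rewrite le_eqVlt => /predU1P[<-|q0] s0 sA.
  by have := sA _ Aa0; rewrite !mul0r.
rewrite mulrC -ler_pdivrMr //.
have sq0 : 0 <= s / q by rewrite divr_ge0 // ltW.
rewrite -(sqr_sqrtr sq0) lerXn2r ?nnegrE ?sqrtr_ge0 //.
  by apply: lb_le_inf => [|_ [a _ <-]]; [exists `|x - a0|, a0|].
apply: lb_le_inf => [|_ [a Aa <-]]; first by exists `|x - a0|, a0.
rewrite -(ler_pXn2r (n := 2)) ?nnegrE ?sqrtr_ge0 // sqr_sqrtr //.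
by rewrite ler_pdivrMr // mulrC sA.
Qed.

Lemma measurable_fun_dist_borel (R : realType) (H : normedModType R) (x : H) :
  measurable_fun setT ((fun y => `|x - y|) : borel H -> R).
Proof.
apply: (measurability _ (RGenOpens.measurableE R)).
move=> _ [_ [a [b ->]] <-]; rewrite setTI; apply: sub_sigma_algebra.
apply: open_comp (@interval_open _ _ _ _ _) => // y _.
by apply: cvg_norm; apply: cvgB; [exact: cvg_cst|exact: cvg_id].
Qed.

Section random_projections.
Context (R : realType) (H : normedModType R) (I : Type).
Context (d : measure_display) (Omega : measurableType d).
Context (P : probability Omega R) (T : I -> H -> H) (xi : Omega -> I).
Context (Cs : I -> set H).
Hypothesis Tproj : forall i, metric_projector (Cs i) (T i).
Hypothesis mdist : forall x : H,
  measurable_fun setT (fun w => `|x - T (xi w) x|).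

Let msqr (x : H) :
  measurable_fun setT (fun w => (`|x - T (xi w) x| ^+ 2)%:E).
Proof. by apply/measurable_EFinP; exact: measurable_funX. Qed.

Lemma measurable_feasible_event (x : H) :
  measurable [set w | Fix (T (xi w)) x].
Proof.
have -> : [set w | Fix (T (xi w)) x] =
    (fun w => `|x - T (xi w) x|) @^-1` [set 0].
  apply/seteqP; split=> w /=; first by move=> ->; rewrite subrr normr0.
  by move/eqP; rewrite normr_eq0 subr_eq0 => /eqP/esym.
by rewrite -[X in measurable X]setTI; exact: mdist.
Qed.

Lemma residual_le_feasible (x c : H) : feasible P T xi c ->
  (residual P T xi x <=
    (`|x - c| ^+ 2)%:E * P (~` [set w | Fix (T (xi w)) x]))%E.
Proof.
move=> Cc; set A := ~` _.
have mA : measurable A by exact/measurableC/measurable_feasible_event.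
rewrite /residual unlock -[A in P A]setIT -integral_indic //.
have mindA : measurable_fun setT (fun w => (\1_A w)%:E : \bar R).
  by apply/measurable_EFinP; exact: measurable_indic.
rewrite -ge0_integralZl //; apply: ae_ge0_le_integral => //.
  exact: measurable_funeM.
have mC : measurable [set w | Fix (T (xi w)) c].
  exact: measurable_feasible_event.
have PC0 : P (~` [set w | Fix (T (xi w)) c]) = 0%E.
  by rewrite probability_setC // Cc subee.
(* The null set to discard: off it [c] lies in [Cs (xi w)] and competes with the projection of
   [x]. *)
exists (~` [set w | Fix (T (xi w)) c]); split => //; first exact: measurableC.
apply: subsetC => w /= Cw _.
rewrite -EFinM lee_fin indicE; case: (pselect (Fix (T (xi w)) x)) => [Fx|Fx].
  by rewrite Fx subrr normr0 expr0n mulr_ge0 ?sqr_ge0.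
rewrite mem_set // mulr1 lerXn2r ?nnegrE //.
by case: (Tproj (xi w) x) => _; apply; rewrite -(Fix_metric_projector (Tproj _)).
Qed.

Lemma residual_ge0 (x : H) : (0 <= residual P T xi x)%E.
Proof.
by rewrite /residual unlock; apply: integral_ge0 => w _; rewrite lee_fin sqr_ge0.
Qed.

(** A nonnegative integrand with zero integral vanishes almost everywhere, and here it vanishes
    exactly where [x] is fixed. *)
Lemma residual0_feasible (x : H) :
  residual P T xi x = 0%E -> feasible P T xi x.
Proof.
rewrite /residual unlock => R0; have mF := measurable_feasible_event x.
have /ae_eq_integral_abs : (\int[P]_w `|(`|x - T (xi w) x| ^+ 2)%:E|)%E = 0%E.
  by rewrite -R0; apply: eq_integral => w _; rewrite gee0_abs // lee_fin sqr_ge0.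
case=> // N [mN PN0 subN].
have PF0 : P (~` [set w | Fix (T (xi w)) x]) = 0%E.
  apply: (subset_measure0 (measurableC mF) mN) PN0 => w /= nF.
  apply: subN => /= /(_ Logic.I) [] /eqP; rewrite sqrf_eq0 normr_eq0 subr_eq0.
  by move=> /eqP/esym.
by rewrite /feasible /= -[X in P X]setCK probability_setC ?PF0 ?sube0 //;
  exact: measurableC.
Qed.

Lemma residual_le_sqr_dist (x : H) : feasible P T xi !=set0 ->
  (residual P T xi x <=
    (dist x (feasible P T xi) ^+ 2)%:E *
    P (~` [set w | Fix (T (xi w)) x]))%E.
Proof.
move=> C0; have [c Cc] := C0; set Q := P _.
have Qfin : Q \is a fin_num.
  by apply: fin_num_measure; exact/measurableC/measurable_feasible_event.
(* One feasible [c] bounds the residual by a real number, so the infimum over [c] can be taken in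
   [R]. *)
have Rfin : residual P T xi x \is a fin_num.
  rewrite ge0_fin_numE ?residual_ge0 //.
  apply: le_lt_trans (residual_le_feasible x Cc) _.
  by rewrite -/Q -(fineK Qfin) -EFinM ltry.
rewrite -(fineK Rfin) -(fineK Qfin) -EFinM lee_fin mulrC.
apply: le_mul_sqr_dist => //.
- exact/fine_ge0/measure_ge0.
- exact/fine_ge0/residual_ge0.
move=> a Ca; have := residual_le_feasible x Ca.
by rewrite -/Q -(fineK Rfin) -(fineK Qfin) -EFinM lee_fin mulrC.
Qed.

End random_projections.

Theorem theorem4p3 (R : realType) (H : completeNormedModType R)
    (ip : {dot H for idfun}) (hip : norm_induced_by ip)
    (hsep : separable H)
    (dI : measure_display) (I : measurableType dI)
    (dO : measure_display) (Omega : measurableType dO)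
    (P : probability Omega R) (xi : {RV P >-> I})
    (T : I -> H -> H)
    (hTcont : forall i, continuous (T i))
    (hTmeas : measurable_fun [set: borel H * I]
                (fun p : borel H * I => T p.2 p.1 : borel H))
    (Cs : I -> set H)
    (hC0 : forall i, Cs i !=set0)
    (hCcl : forall i, closed (Cs i))
    (hCcv : forall i, convex_set (Cs i))
    (hTproj : forall i, metric_projector (Cs i) (T i))
    (hfeas : feasible P T xi !=set0)
    (kappa : R) (hkappa : 0 < kappa)
    (hreg : forall x : H,
      ((dist x (feasible P T xi) ^+ 2)%:E <= kappa%:E * residual P T xi x)%E) :
  exists r : R, r < 1 /\
    forall x : H, ~ feasible P T xi x -> (P [set w | Cs (xi w) x] <= r%:E)%E.

Proof.
(* The map is the composite of [w |-> (x, xi w)], the jointly measurable [T], and the distance to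
   [x]. *)
have mdist x : measurable_fun setT (fun w => `|x - T (xi w) x|).
  have mpair : measurable_fun setT (fun w => (x : borel H, xi w)).
    by apply: measurable_fun_pair => //; exact: measurable_cst.
  exact: (measurableT_comp (measurable_fun_dist_borel x)
           (measurableT_comp hTmeas mpair)).
(* This value is negative when [kappa < 1]; the two residual bounds then force the distance to
   vanish, so no infeasible point exists. *)
exists (1 - kappa^-1); split; first by rewrite gtrBl invr_gt0.
move=> x nCx.
have -> : [set w | Cs (xi w) x] = [set w | Fix (T (xi w)) x].
  by apply/seteqP; split=> w /=; rewrite (Fix_metric_projector (hTproj _)).
have mF := measurable_feasible_event mdist x.
have Rle := residual_le_sqr_dist hTproj mdist x hfeas.
have := hreg x; set D := dist _ _ in Rle *; set F := [set w | _] in mF Rle *.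
move: Rle; rewrite (probability_setC P mF).
have Ffin : P F \is a fin_num by exact: fin_num_measure.
rewrite -(fineK Ffin) -EFinB -EFinM lee_fin => Rle Dle.
have : D ^+ 2 <= kappa * (D ^+ 2 * (1 - fine (P F))).
  rewrite -lee_fin (EFinM kappa); apply: le_trans Dle _.
  by rewrite lee_pmul2l // lte_fin.
(* With [D = 0], [Rle] makes the residual zero and [x] feasible, against [nCx]. *)
have D2 : 0 < D ^+ 2.
  rewrite lt_neqAle sqr_ge0 andbT eq_sym; apply/eqP => D0; apply: nCx.
  apply: (residual0_feasible mdist); apply/eqP.
  by rewrite eq_le residual_ge0 andbT (le_trans Rle) // D0 mul0r.
(* Cancelling [D ^+ 2] leaves [1 <= kappa * (1 - fine (P F))], which is then divided by [kappa]. *)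
rewrite mulrCA -[leLHS]mulr1 ler_pM2l // -ler_pdivrMl // mulr1.
by rewrite lerBrDr -lerBrDl.
Qed.
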